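(* Let $G = \prod_{p} D_p$ be the profinite group given by the direct product, over all odd primes $p$, of the dihedral groups $D_p$ of order $2p$. Then $G$ is axiomatizable; that is, for every profinite group $\Lambda$ with the same first-order theory as that of $G$, we have $\Lambda \cong G$.
   Context: For an odd prime $p$, $D_p$ denotes the dihedral group of order $2p$: the semidirect product $C_p \rtimes \{\tau \in \mathrm{Aut}(C_p) \mid \tau^2 = \mathrm{Id}\}$, where $C_p$ is the cyclic group of order $p$ and the second factor (a group of order $2$, generated by inversion) acts naturally on $C_p$. Each $D_p$ is finite and discrete, and the direct product carries the product topology, making it a profinite group. The first-order theory of a profinite group is the set of all first-order sentences in the language of groups that hold in its underlying abstract group (the topology is not part of the language). A profinite group $\Gamma$ is called axiomatizable if for every profinite group $\Lambda$ with the same first-order theory as that of $\Gamma$, we have $\Lambda \cong \Gamma$. Here $\cong$ denotes isomorphism of profinite groups, i.e. a group isomorphism that is also a homeomorphism. *)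

(* Defs.v *)
From HB Require Import structures.
From mathcomp Require Import all_boot all_order all_algebra all_fingroup all_solvable.
From mathcomp Require Import all_classical all_reals all_analysis.

Set Implicit Arguments.
Unset Strict Implicit.
Unset Printing Implicit Defensive.

Local Open Scope classical_set_scope.
Local Open Scope group_scope.

(** * Profinite groups *)

HB.structure Definition PreTopologicalGroup := {G of Topological G & monoid.Group G}.

HB.mixin Record PreTopologicalGroup_isTopologicalGroup G
    of PreTopologicalGroup G := {
  mulg_continuous : continuous (fun z : G * G => z.1 * z.2);
  invg_continuous : continuous (fun x : G => x^-1)
}.

#[short(type="topologicalGroupType")]
HB.structure Definition TopologicalGroup :=
  {G of PreTopologicalGroup_isTopologicalGroup G & PreTopologicalGroup G}.

HB.mixin Record TopologicalGroup_isProfinite G of TopologicalGroup G := {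
  profinite_compact : compact [set: G];
  profinite_hausdorff : hausdorff_space G;
  profinite_totally_disconnected : totally_disconnected [set: G]
}.

#[short(type="profiniteGroupType")]
HB.structure Definition ProfiniteGroup :=
  {G of TopologicalGroup_isProfinite G & TopologicalGroup G}.

Definition profinite_isomorphic (G H : profiniteGroupType) : Prop :=
  exists (f : G -> H) (g : H -> G),
    [/\ {morph f : x y / x * y}, cancel f g, cancel g f,
        continuous f & continuous g].

(** * Finite discrete groups are profinite *)

Section FiniteDiscrete.
Variable gT : finGroupType.

HB.instance Definition _ := monoid.Group.copy (discrete_topology gT) gT.

Lemma discrete_mulg_continuous :
  continuous (fun z : discrete_topology gT * discrete_topology gT => z.1 * z.2).
Proof.
case=> a b U /nbhs_singleton Uab.
exists ([set a], [set b]) => /=; first by split; apply: discrete_set1.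
by case=> x y /= [-> ->].
Qed.

Lemma discrete_invg_continuous :
  continuous (fun x : discrete_topology gT => x^-1).
Proof.
move=> a U /nbhs_singleton Ua.
apply: (@filterS _ (nbhs a) _ [set a]); last exact: discrete_set1.
by move=> x ->.
Qed.

HB.instance Definition _ := PreTopologicalGroup_isTopologicalGroup.Build
  (discrete_topology gT) discrete_mulg_continuous discrete_invg_continuous.

Lemma discrete_compact : compact [set: discrete_topology gT].
Proof. by apply: finite_compact; exact: (@finite_finset gT). Qed.

Lemma discrete_totally_disconnected :
  totally_disconnected [set: discrete_topology gT].
Proof.
exact: zero_dimension_totally_disconnected discrete_zero_dimension.
Qed.

HB.instance Definition _ := TopologicalGroup_isProfinite.Build
  (discrete_topology gT) discrete_compact discrete_hausdorff
  discrete_totally_disconnected.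

End FiniteDiscrete.

(** * Direct products, with the product topology *)

Section Product.
Variable I : choiceType.

Section TopologicalGroupProduct.
Variable G : I -> topologicalGroupType.
Implicit Types x y z : prod_topology G.

Definition prod_one : prod_topology G := fun=> 1.
Definition prod_mul x y : prod_topology G := fun i => x i * y i.
Definition prod_inv x : prod_topology G := fun i => (x i)^-1.

Fact prod_mulA : associative prod_mul.
Proof. by move=> x y z; apply: functional_extensionality_dep => i; apply: mulgA. Qed.
Fact prod_mul1 : left_id prod_one prod_mul.
Proof. by move=> x; apply: functional_extensionality_dep => i; apply: mul1g. Qed.
Fact prod_mulr1 : right_id prod_one prod_mul.
Proof. by move=> x; apply: functional_extensionality_dep => i; apply: mulg1. Qed.
Fact prod_mulV : left_inverse prod_one prod_inv prod_mul.
Proof. by move=> x; apply: functional_extensionality_dep => i; apply: mulVg. Qed.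
Fact prod_mulrV : right_inverse prod_one prod_inv prod_mul.
Proof. by move=> x; apply: functional_extensionality_dep => i; apply: mulgV. Qed.

HB.instance Definition _ := isGroup.Build (prod_topology G)
  prod_mulA prod_mul1 prod_mulr1 prod_mulV prod_mulrV.

Lemma prod_topology_continuous (T : topologicalType) (f : T -> prod_topology G) :
  (forall i, continuous (fun t => f t i)) -> continuous f.
Proof.
move=> fc t; apply/cvg_sup => i U [V [[W oW <-] /= Wft] sVU].
have : nbhs (f t i) W by apply: open_nbhs_nbhs; split.
by move/(fc i t); exact: (@filterS _ (nbhs t) _ _ (f @^-1` U) (fun u => sVU (f u))).
Qed.

Lemma prod_mulg_continuous :
  continuous (fun z : prod_topology G * prod_topology G => z.1 * z.2).
Proof.
apply: prod_topology_continuous => i z.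
apply: (continuous_comp
  (f := fun z : prod_topology G * prod_topology G => (z.1 i, z.2 i))
  (g := fun w : G i * G i => w.1 * w.2)); last exact: mulg_continuous.
apply: cvg_pair => /=.
  apply: (@cvg_comp _ _ _ fst (@proj I G i)); first exact: cvg_fst.
  exact: proj_continuous.
apply: (@cvg_comp _ _ _ snd (@proj I G i)); first exact: cvg_snd.
exact: proj_continuous.
Qed.

Lemma prod_invg_continuous : continuous (fun x : prod_topology G => x^-1).
Proof.
apply: prod_topology_continuous => i x.
apply: (@continuous_comp _ _ _ (fun x : prod_topology G => x i)
  (fun y : G i => y^-1)); last exact: invg_continuous.
exact: (@proj_continuous I G i).
Qed.

HB.instance Definition _ := PreTopologicalGroup_isTopologicalGroup.Build
  (prod_topology G) prod_mulg_continuous prod_invg_continuous.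

End TopologicalGroupProduct.

Section ProfiniteProduct.
Variable G : I -> profiniteGroupType.

Lemma prod_compact : compact [set: prod_topology G].
Proof.
have := tychonoff (fun i => @profinite_compact (G i)).
by congr (compact _); apply/seteqP; split.
Qed.

Lemma prod_hausdorff : hausdorff_space (prod_topology G).
Proof. exact: (hausdorff_product (fun i => @profinite_hausdorff (G i))). Qed.

Lemma prod_totally_disconnected : totally_disconnected [set: prod_topology G].
Proof.
have := totally_disconnected_prod
  (fun i => @profinite_totally_disconnected (G i)).
by congr (totally_disconnected _); apply/seteqP; split.
Qed.

HB.instance Definition _ := TopologicalGroup_isProfinite.Build
  (prod_topology G) prod_compact prod_hausdorff prod_totally_disconnected.

End ProfiniteProduct.
End Product.

(** * First-order logic in the language of groups *)

Inductive group_term : Type :=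
| GVar of nat
| GOne
| GMul of group_term & group_term
| GInv of group_term.

Inductive group_formula : Type :=
| GEqual of group_term & group_term
| GNot of group_formula
| GAnd of group_formula & group_formula
| GOr of group_formula & group_formula
| GImplies of group_formula & group_formula
| GForall of nat & group_formula
| GExists of nat & group_formula.

Fixpoint term_vars (t : group_term) : seq nat :=
  match t with
  | GVar n => [:: n]
  | GOne => [::]
  | GMul t1 t2 => term_vars t1 ++ term_vars t2
  | GInv t1 => term_vars t1
  end.

Fixpoint free_vars (f : group_formula) : seq nat :=
  match f with
  | GEqual t1 t2 => term_vars t1 ++ term_vars t2
  | GNot f1 => free_vars f1
  | GAnd f1 f2 | GOr f1 f2 | GImplies f1 f2 => free_vars f1 ++ free_vars f2
  | GForall n f1 | GExists n f1 => [seq m <- free_vars f1 | m != n]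
  end.

Definition group_sentence (f : group_formula) : Prop := free_vars f = [::].

Section Semantics.
Variable G : groupType.
Implicit Types e : nat -> G.

Definition update e (n : nat) (x : G) : nat -> G :=
  fun m => if m == n then x else e m.

Fixpoint group_eval e (t : group_term) : G :=
  match t with
  | GVar n => e n
  | GOne => 1
  | GMul t1 t2 => group_eval e t1 * group_eval e t2
  | GInv t1 => (group_eval e t1)^-1
  end.

Fixpoint group_holds e (f : group_formula) : Prop :=
  match f with
  | GEqual t1 t2 => group_eval e t1 = group_eval e t2
  | GNot f1 => ~ group_holds e f1
  | GAnd f1 f2 => group_holds e f1 /\ group_holds e f2
  | GOr f1 f2 => group_holds e f1 \/ group_holds e f2
  | GImplies f1 f2 => group_holds e f1 -> group_holds e f2
  | GForall n f1 => forall x, group_holds (update e n x) f1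
  | GExists n f1 => exists x, group_holds (update e n x) f1
  end.

(* The environment is irrelevant, since a sentence has no free variable. *)
Definition first_order_theory : set group_formula :=
  [set f | group_sentence f /\ group_holds (fun=> 1) f].

End Semantics.

Definition axiomatizable (Gamma : profiniteGroupType) : Prop :=
  forall Lambda : profiniteGroupType,
    first_order_theory Lambda = first_order_theory Gamma ->
    profinite_isomorphic Lambda Gamma.

(** * The product of the dihedral groups *)

Definition odd_prime : Type := {p : nat | odd p && prime p}.

HB.instance Definition _ := Choice.on odd_prime.

(* 'D_m is indexed by its order m: for p an odd prime, 'D_(2 * p) is the
   semidirect product of 'Z_p by a group of order 2 acting by inversion. *)
Definition dihedral_product : profiniteGroupType :=
  prod_topology (fun p : odd_prime => discrete_topology 'D_(2 * val p)).

(* Main.v *)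
From HB Require Import structures.
From mathcomp Require Import all_boot all_order all_algebra all_fingroup all_solvable.
From mathcomp Require Import all_classical all_reals all_analysis.
Require Import Defs.

Set Implicit Arguments.
Unset Strict Implicit.
Unset Printing Implicit Defensive.

Local Open Scope classical_set_scope.
Local Open Scope group_scope.

(** Why the theorem holds. Write [C(X)] for the centralizer of [X].  For each
    odd prime [p], the product [G] satisfies a sentence saying that there is a
    copy of the finite group [D_p] with [G = D_p C(D_p)], and that every square
    [c ^+ 2] of an element [c] of [C(D_p)] is a [2p]-th power
    ([factor_formula]).  Indeed the squares of [C(D_p)] are rotations at the
    primes other than [p], whose orders are prime to [p].  For the same reason
    every square of [G] is a fourth power ([square_formula]); and [G] has no
    nontrivial normal subgroup of exponent 2 ([normal2_formula]).

    Let [L] be a profinite group with the theory of [G].  As [D_p] is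
    centerless, the first sentence makes [L] the direct product of [D_p] and
    [C(D_p)], so it yields a projection [coord p] of [L] onto [D_p], which is
    continuous because its fibres are closed and finitely many.  The product of
    these projections is a continuous morphism [L -> G].

    It is surjective ([coord_surjective]): for [p <> q] the copy of [D_q] in
    [L] projects trivially to [D_p] ([coord_factor_neq]), so finitely many
    coordinates can be prescribed freely, and compactness gives all of them.

    It is injective ([coord_kernel_trivial]): let [x] lie in the kernel.  If
    [x ^+ 2 = z ^+ (2 * m)], write [z = d c] with [d] in [D_p] and [c] in
    [C(D_p)]; the projection to [D_p] shows that [d ^+ (2 * m) = 1], whence
    [x ^+ 2 = c ^+ (2 * m)], and [c ^+ 2] is a [2p]-th power.  Thus [x ^+ 2]
    is a [2mp]-th power; by the second sentence it is also a [4m]-th power.  An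
    induction on the prime factors of [n] makes [x ^+ 2] a [2n]-th power for
    all [n > 0].  In a profinite group this forces
    [x ^+ 2 = 1] ([infinitely_divisible_eq1]).  So the kernel is a normal
    subgroup of exponent 2, and the third sentence makes it trivial.

    A continuous bijection from a compact space to a Hausdorff space is a
    homeomorphism, which concludes. *)

(** * Compactness in profinite groups *)

(** The form of compactness used throughout: a downward directed family of
    nonempty closed sets has a common point. *)
Lemma compact_bigcap_nonempty (T : topologicalType) (I : Type) (D : set I)
    (f : I -> set T) :
  compact [set: T] -> (exists i, D i) ->
  (forall i j, D i -> D j -> exists2 k, D k & f k `<=` f i `&` f j) ->
  (forall i, D i -> closed (f i)) -> (forall i, D i -> f i !=set0) ->
  exists x, forall i, D i -> f i x.
Proof.
move=> cT D0 fdir fcl f0.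
have FF := filter_from_proper (filter_from_filter D0 fdir) f0.
have [|x [_ xcl]] := cT _ FF; first exact: filterT.
exists x => i Di; apply: fcl => // B xB.
by apply: xcl => //; exists i.
Qed.

Lemma closed_equalizer (T U : topologicalType) (f g : T -> U) :
  hausdorff_space U -> continuous f -> continuous g ->
  closed [set x | f x = g x].
Proof.
move=> hU cf cg x clx; apply: hU => A B fA gB.
have fgx : nbhs x (f @^-1` A `&` g @^-1` B).
  by apply: filterI; [apply: cf | apply: cg].
have [y [/= fgy [Ay By]]] := clx _ fgx.
by exists (f y); split=> //; rewrite fgy.
Qed.

Lemma bijective_continuous_inv (T U : topologicalType) (f : T -> U)
    (g : U -> T) :
  compact [set: T] -> hausdorff_space U -> continuous f ->
  cancel f g -> cancel g f -> continuous g.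
Proof.
move=> cT hU cf fK gK; apply/continuous_closedP => A clA.
have -> : g @^-1` A = f @` A.
  apply/seteqP; split=> [y Ay|_ [x Ax <-]] /=; last by rewrite fK.
  by exists (g y); rewrite ?gK.
apply: compact_closed => //; apply: continuous_compact.
  exact: continuous_subspaceT.
exact: subclosed_compact cT _.
Qed.

(** In a compact Hausdorff space the intersection [Q] of the clopen sets
    around [x] is connected, so total disconnectedness reduces it to [x].
    If [Q] were split into two disjoint closed parts, normality would give an
    open [U] around one part whose closure misses the other; the frontier of
    [U] then misses [Q], so by compactness it misses a clopen [V] around [x],
    and one of the clopen sets [V `&` U], [V `&` ~` U] contains [x] but only
    one part of [Q]. *)
Lemma clopen_separation (T : topologicalType) (x y : T) :
  compact [set: T] -> hausdorff_space T -> totally_disconnected [set: T] ->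
  x <> y -> exists V : set T, [/\ clopen V, V x & ~ V y].
Proof.
move=> cT hT dT; apply: contra_notP => /forallNP inQ.
pose Q := [set z | forall V, clopen V -> V x -> V z].
suff Qcon : connected Q.
  have Qx : Q x by [].
  have Qy : Q y by move=> V cV Vx; apply: contrapT => nVy; apply: (inQ V).
  have: connected_component [set: T] x y by exists Q.
  by rewrite dT.
have Qcl : closed Q.
  move=> z clz V [oV cV] Vx; apply: (cV) => B Bz.
  have [w [Qw Bw]] := clz _ Bz; exists w; split=> //.
  exact: (Qw V (conj oV cV) Vx).
move=> B [b Bb] [C oC BC] [D cD BD].
have BQ : B `<=` Q by rewrite BC => z [].
have clB : closed B by rewrite BD; exact: closedI.
have clQB : closed (Q `&` ~` C) by apply: closedI => //; exact: open_closedC.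
apply/seteqP; split=> // w Qw; apply: contrapT => nBw.
have [W /set_nbhsP [U [oU BU UW]] WQB] :
    filter_from (set_nbhs B) closure (~` (Q `&` ~` C)).
  apply: (compact_normal hT cT clB); apply/set_nbhsP.
  exists (~` (Q `&` ~` C)); split=> //; first exact: closed_openC.
  by move=> z Bz [_]; apply; move: Bz; rewrite BC => -[].
have UQB z : closure U z -> Q z -> B z.
  move=> /(closureS UW)/WQB /= nz Qz; rewrite BC; split=> //.
  by apply: contrapT => nCz; apply: nz.
have [V [[oV cV] Vx] VF] : exists2 V : set T, clopen V /\ V x &
    V `&` (closure U `&` ~` U) = set0.
  apply: contrapT => nV.
  have [||||z zV] := compact_bigcap_nonempty
    (f := fun V => V `&` (closure U `&` ~` U))
    (D := [set V : set T | clopen V /\ V x]) cT.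
  - by exists setT; split=> //; exact: clopenT.
  - move=> V1 V2 [c1 x1] [c2 x2]; exists (V1 `&` V2).
      by split=> //; exact: clopenI.
    by move=> t [[? ?] ?].
  - move=> V [[_ cV] _]; apply: closedI => //.
    apply: closedI; first exact: closed_closure.
    exact: open_closedC.
  - move=> V cV; apply/set0P/negP => /eqP V0; apply: nV.
    by exists V.
  - have [] := zV setT; first by split=> //; exact: clopenT.
    move=> _ [clUz nUz]; apply: nUz; apply: BU; apply: UQB => // V cV Vx.
    by have [] := zV V.
have VclU : V `&` U = V `&` closure U.
  apply/seteqP; split=> z [Vz Uz]; split=> //; first exact: subset_closure.
  by apply: contrapT => nUz; have : set0 z by rewrite -VF.
have [Ux|nUx] := pselect (U x).
  have [_ Uw] : (V `&` U) w.
    apply: (Qw (V `&` U)); last by split.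
    split; first exact: openI.
    by rewrite VclU; apply: closedI => //; exact: closed_closure.
  by apply: nBw; apply: UQB => //; exact: subset_closure.
have [_ nUb] : (V `&` ~` U) b; last by apply: nUb; apply: BU.
apply: (BQ b Bb (V `&` ~` U)); last by split.
split; last by apply: closedI => //; exact: open_closedC.
suff -> : V `&` ~` U = V `&` ~` closure U.
  by apply: openI => //; apply: closed_openC; exact: closed_closure.
apply/seteqP; split=> z [Vz nz]; split=> // Uz; apply: nz.
  by have [] : (V `&` U) z by rewrite VclU.
exact: subset_closure.
Qed.

Lemma expg_continuous (G : topologicalGroupType) (n : nat) :
  continuous (fun x : G => x ^+ n).
Proof.
elim: n => [|n IH] x; first exact: cvg_cst.
rewrite (_ : (fun x : G => x ^+ n.+1) = (fun x => x * x ^+ n)); last first.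
  by apply/funext => y; rewrite expgS.
apply: (continuous_comp (f := fun y : G => (y, y ^+ n))
  (g := fun w : G * G => w.1 * w.2)); last exact: mulg_continuous.
by apply: cvg_pair => //; exact: IH.
Qed.

Lemma mulgl_continuous (G : topologicalGroupType) (a : G) :
  continuous (fun x : G => a * x).
Proof.
move=> x; apply: (continuous_comp (f := fun y : G => (a, y))
  (g := fun w : G * G => w.1 * w.2)); last exact: mulg_continuous.
by apply: cvg_pair => //; exact: cvg_cst.
Qed.

Lemma mulgr_continuous (G : topologicalGroupType) (a : G) :
  continuous (fun x : G => x * a).
Proof.
move=> x; apply: (continuous_comp (f := fun y : G => (y, a))
  (g := fun w : G * G => w.1 * w.2)); last exact: mulg_continuous.
by apply: cvg_pair => //; exact: cvg_cst.
Qed.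

(** The subgroup is the stabilizer of [V] under left translation; its
    complement is a projection of a closed subset of the compact [G * G]. *)
Lemma open_subgroup_in_clopen (G : profiniteGroupType) (V : set G) :
  clopen V -> V 1 ->
  exists H : set G, [/\ open H, H 1, forall x y, H x -> H y -> H (x^-1 * y)
    & H `<=` V].
Proof.
move=> [oV cV] V1.
pose R := [set z : G * G | V z.2 /\ ~ (V (z.1 * z.2) /\ V (z.1^-1 * z.2))].
pose H := [set h : G | forall v, V v -> V (h * v) /\ V (h^-1 * v)].
have HR : H = ~` (fst @` R).
  apply/seteqP; split=> h /=.
    by move=> Hh [[h' v] [/= Vv nV] hh']; rewrite hh' in nV; apply: nV; apply: Hh.
  by move=> nR v Vv; apply: contrapT => nV; apply: nR; exists (h, v).
have cm : continuous (fun z : G * G => z.1^-1 * z.2).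
  move=> z; apply: (continuous_comp (f := fun z : G * G => (z.1^-1, z.2))
    (g := fun w : G * G => w.1 * w.2)); last exact: mulg_continuous.
  apply: cvg_pair; last exact: cvg_snd.
  by apply: continuous_comp; [exact: cvg_fst | exact: invg_continuous].
have clR : closed R.
  have -> : R = snd @^-1` V `&` ~` ((fun z : G * G => z.1 * z.2) @^-1` V `&`
      (fun z : G * G => z.1^-1 * z.2) @^-1` V) by [].
  apply: closedI.
    have /continuous_closedP : continuous (@snd G G) by move=> z; exact: cvg_snd.
    exact.
  apply: open_closedC; apply: openI.
    have /continuousP := @mulg_continuous G; exact.
  by move/continuousP: cm; exact.
have cGG : compact [set: G * G].
  by rewrite -setXTT; apply: compact_setX; exact: profinite_compact.
exists H; split.
- rewrite HR; apply: closed_openC; apply: compact_closed.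
    exact: profinite_hausdorff.
  apply: continuous_compact; last exact: subclosed_compact cGG _.
  by apply: continuous_subspaceT => z; exact: cvg_fst.
- by move=> v Vv; rewrite invg1 mul1g.
- move=> x y Hx Hy v Vv; rewrite invgM invgK -!mulgA; split.
    by apply: (Hx _ _).2; apply: (Hy _ _).1.
  by apply: (Hy _ _).2; apply: (Hx _ _).1.
- by move=> h Hh; rewrite -[h]mulg1; apply: (Hh _ V1).1.
Qed.

Section OpenSubgroup.
Variables (G : profiniteGroupType) (H : set G).
Hypotheses (oH : open H) (H1 : H 1).
Hypothesis HdV : forall x y, H x -> H y -> H (x^-1 * y).

Lemma open_subgroup_inv x : H x -> H x^-1.
Proof. by move=> Hx; rewrite -[x^-1]mulg1; apply: HdV. Qed.

Lemma open_subgroup_mul x y : H x -> H y -> H (x * y).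
Proof. by move=> /open_subgroup_inv Hx Hy; rewrite -[x]invgK; apply: HdV. Qed.

Lemma open_subgroup_exp x n : H x -> H (x ^+ n).
Proof.
move=> Hx; elim: n => [|n IH]; first by rewrite expg0.
by rewrite expgS; apply: open_subgroup_mul.
Qed.

(** The powers of [z] accumulate at some [c], so two of them lie in the same
    coset [c H]. *)
Lemma open_subgroup_some_power z : exists2 k : nat, (0 < k)%N & H (z ^+ k).
Proof.
pose f n := closure [set z ^+ m | m in [set m | (n <= m)%N]].
have [||||c fc] := compact_bigcap_nonempty (f := f) (D := setT)
  (@profinite_compact G).
- by exists 0%N.
- move=> i j _ _; exists (maxn i j) => //.
  by move=> w clw; split; move: w clw; apply: closureS => _ [m /= ij <-];
    exists m => //=; move: ij; rewrite geq_max => /andP[].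
- by move=> i _; exact: closed_closure.
- by move=> i _; exists (z ^+ i); apply: subset_closure; exists i => /=.
have cH : nbhs c ((fun y => c^-1 * y) @^-1` H).
  by apply: mulgl_continuous; apply: open_nbhs_nbhs; rewrite mulVg.
have [_ [[k _ <-] /= Hk]] := fc 0%N I _ cH.
have [_ [[m /= km <-] /= Hm]] := fc k.+1 I _ cH.
exists (m - k)%N; first by rewrite subn_gt0.
have := HdV Hk Hm.
by rewrite invgM invgK -mulgA mulVKg -{1}(subnKC (ltnW km)) expgnDr mulKg.
Qed.

(** A single exponent serves all [z], by compactness: the sets of the [z] with
    [z ^+ n] in [H] are open, cover [G], and are directed upwards for
    divisibility of [n]. *)
Lemma open_subgroup_exponent :
  exists2 n : nat, (0 < n)%N & forall z, H (z ^+ n).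
Proof.
apply: contrapT => nex.
have [||||c fc] := compact_bigcap_nonempty (D := [set n : nat | (0 < n)%N])
  (f := fun n => [set z : G | ~ H (z ^+ n)]) (@profinite_compact G).
- by exists 1%N.
- move=> i j /= i0 j0; exists (i * j)%N; first by rewrite muln_gt0 i0.
  move=> z nz; split=> Hz; apply: nz; last rewrite mulnC;
    by rewrite expgnA; exact: open_subgroup_exp.
- move=> i _; apply: open_closedC.
  by have /continuousP := @expg_continuous G i; exact.
- move=> i i0; apply: contrapT => n0; apply: nex; exists i => // z.
  by apply: contrapT => nHz; apply: n0; exists z.
- by have [k k0 Hk] := open_subgroup_some_power c; apply: fc Hk.
Qed.

End OpenSubgroup.

(** Such an element belongs to every open subgroup. *)
Lemma infinitely_divisible_eq1 (G : profiniteGroupType) (x : G) :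
  (forall n, (0 < n)%N -> exists z, x = z ^+ n) -> x = 1.
Proof.
move=> divx; apply: contrapT => /nesym /(clopen_separation
  (@profinite_compact G) (@profinite_hausdorff G)
  (@profinite_totally_disconnected G)) [V [cV V1 nVx]].
have [H [oH H1 HdV HV]] := open_subgroup_in_clopen cV V1.
have [n n0 Hn] := open_subgroup_exponent oH H1 HdV.
by have [z xz] := divx n n0; apply: nVx; rewrite xz; apply/HV/Hn.
Qed.

(** * Truth of formulas *)

Section Environments.
Variable G : groupType.
Implicit Types (e : nat -> G) (t : group_term) (f : group_formula) (s : seq nat).

Lemma eq_in_group_eval e e' t :
  {in term_vars t, e =1 e'} -> group_eval e t = group_eval e' t.
Proof.
elim: t => [n||t1 IH1 t2 IH2|t IH] //= ee'.
- by apply: ee'; rewrite inE.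
- by rewrite IH1 ?IH2 // => m mt; apply: ee'; rewrite mem_cat mt ?orbT.
- by rewrite IH.
Qed.

Lemma eq_in_group_holds e e' f :
  {in free_vars f, e =1 e'} -> group_holds e f <-> group_holds e' f.
Proof.
elim: f e e' => [t1 t2|f IH|f1 IH1 f2 IH2|f1 IH1 f2 IH2|f1 IH1 f2 IH2|n f IH|n f IH]
  e e' /= ee'; last 2 first.
- have E x : group_holds (update e n x) f <-> group_holds (update e' n x) f.
    by apply: IH => m mf; rewrite /update; case: eqP => // /eqP mn;
      apply: ee'; rewrite mem_filter mn.
  by split=> + x => /(_ x)/E.
- have E x : group_holds (update e n x) f <-> group_holds (update e' n x) f.
    by apply: IH => m mf; rewrite /update; case: eqP => // /eqP mn;
      apply: ee'; rewrite mem_filter mn.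
  by split=> -[x /E]; exists x.
- rewrite !(@eq_in_group_eval e e') // => m mt;
    by apply: ee'; rewrite mem_cat mt ?orbT.
- by rewrite (IH e e').
all: by rewrite (IH1 e e') ?(IH2 e e') // => m mf; apply: ee';
  rewrite mem_cat mf ?orbT.
Qed.

Definition GForalls s f := foldr GForall f s.
Definition GExistss s f := foldr GExists f s.

Lemma holds_GForalls e s f : group_holds e (GForalls s f) <->
  forall e', (forall m, m \notin s -> e' m = e m) -> group_holds e' f.
Proof.
elim: s e => [|n s IH] e /=.
  split=> [ef e' ee'|]; last exact.
  by apply: (eq_in_group_holds _).2 ef => m _; exact: ee'.
split=> [ef e' ee'|ef x].
  apply: (IH _).1 (ef (e' n)) _ _ => m ms; rewrite /update.
  by case: eqP => [->//|/eqP mn]; apply: ee'; rewrite inE negb_or mn.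
apply/IH => e' ee'; apply: ef => m; rewrite inE negb_or => /andP[mn ms].
by rewrite ee' // /update (negPf mn).
Qed.

Lemma holds_GExistss e s f : group_holds e (GExistss s f) <->
  exists2 e', (forall m, m \notin s -> e' m = e m) & group_holds e' f.
Proof.
elim: s e => [|n s IH] e /=.
  split=> [ef|[e' ee' ef]]; first by exists e.
  by apply: (eq_in_group_holds _).2 ef => m _; rewrite ee'.
split=> [[x /IH[e' ee' ef]]|[e' ee' ef]].
  exists e' => // m; rewrite inE negb_or => /andP[mn ms].
  by rewrite ee' // /update (negPf mn).
exists (e' n); apply/IH; exists e' => // m ms; rewrite /update.
by case: eqP => [->//|/eqP mn]; apply: ee'; rewrite inE negb_or mn.
Qed.

Definition GConjs (T : finType) (F : T -> group_formula) :=
  foldr (fun i => GAnd (F i)) (GEqual GOne GOne) (enum T).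
Definition GDisjs (T : finType) (F : T -> group_formula) :=
  foldr (fun i => GOr (F i)) (GNot (GEqual GOne GOne)) (enum T).

Lemma holds_GConjs e (T : finType) (F : T -> group_formula) :
  group_holds e (GConjs F) <-> forall i, group_holds e (F i).
Proof.
suff E (r : seq T) : group_holds e (foldr (fun i => GAnd (F i)) (GEqual GOne GOne) r) <->
    {in r, forall i, group_holds e (F i)}.
  split=> [/E eF i|eF]; first by apply: eF; rewrite mem_enum.
  by apply/E => i _; exact: eF.
elim: r => [|j r IH] //=; split=> [[Fj /IH Fs] i|Fs].
  by rewrite inE => /predU1P[->|/Fs].
split; first by apply: Fs; rewrite mem_head.
by apply/IH => i si; apply: Fs; rewrite inE si orbT.
Qed.

Lemma holds_GDisjs e (T : finType) (F : T -> group_formula) :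
  group_holds e (GDisjs F) <-> exists i, group_holds e (F i).
Proof.
suff E (r : seq T) : group_holds e (foldr (fun i => GOr (F i)) (GNot (GEqual GOne GOne)) r)
    <-> exists2 i, i \in r & group_holds e (F i).
  split=> [/E[i _ eF]|[i eF]]; first by exists i.
  by apply/E; exists i; rewrite ?mem_enum.
elim: r => [|j r IH] /=; first by split=> [|[]].
split=> [[Fj|/IH[i si Fi]]|[i]]; first by exists j; rewrite ?mem_head.
  by exists i; rewrite // inE si orbT.
by rewrite inE => /predU1P[->|si Fi]; [left | right; apply/IH; exists i].
Qed.

Definition GPow t n := iter n (GMul t) GOne.

Lemma group_eval_pow e t n : group_eval e (GPow t n) = group_eval e t ^+ n.
Proof. by elim: n => [|n IH] //; rewrite expgS -IH. Qed.

End Environments.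

Lemma free_vars_GForalls s f :
  free_vars (GForalls s f) = [seq m <- free_vars f | m \notin s].
Proof.
elim: s => [|n s IH] /=; first by rewrite filter_predT.
rewrite IH -filter_predI; apply: eq_filter => m /=.
by rewrite inE negb_or.
Qed.

(** Truth under all assignments, for an arbitrary formula, is truth of its
    universal closure.  Stated in this way, elementary equivalence can be used
    without computing the free variables of any particular formula. *)
Lemma first_order_transfer (G L : groupType) f :
  first_order_theory L = first_order_theory G ->
  (forall e : nat -> G, group_holds e f) -> forall e : nat -> L, group_holds e f.
Proof.
move=> LG Gf e; pose c := GForalls (free_vars f) f.
have [_ Lc] : first_order_theory L c.
  rewrite LG; split.
    rewrite /group_sentence free_vars_GForalls -(filter_pred0 (free_vars f)).
    by apply: eq_in_filter => m ->.
  by apply/holds_GForalls => e' _; exact: Gf.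
pose e1 m := if m \in free_vars f then e m else 1.
have : group_holds e1 f.
  by apply: (holds_GForalls _ _ _).1 Lc _ _ => m mf; rewrite /e1 (negPf mf).
by apply: (eq_in_group_holds _).1 => m mf; rewrite /e1 mf.
Qed.

(** An embedded copy of [F] that generates [G] together with its centralizer;
    for centerless [F] this presents [G] as the direct product of the two.
    Multiplying by [h g] on the left is the form that needs no inverse in the
    corresponding formula. *)
Record direct_factor (F : finGroupType) (G : groupType) (h : F -> G) : Prop := {
  factor_morph : {morph h : x y / x * y};
  factor_ker1 : forall g, h g = 1 -> g = 1;
  factor_split : forall x, exists g, forall k, commute (h g * x) (h k)
}.

Section FactorFormula.
Variable F : finGroupType.

(** The variables 0 and 1 are kept for the bound variables of
    [factor_formula]. *)
Definition factor_var (g : F) : nat := (pickle g).+2.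
Local Notation v g := (GVar (factor_var g)).

Definition GCommute t1 t2 := GEqual (GMul t1 t2) (GMul t2 t1).

(** The multiplication table of [F] is finite, so an embedding of [F] is a
    tuple of elements subject to finitely many equations and inequations. *)
Definition factor_formula n :=
  GExistss [seq factor_var g | g : F]
   (GAnd (GConjs (fun g => GConjs (fun k => GEqual (v (g * k)) (GMul (v g) (v k)))))
   (GAnd (GConjs (fun g => if g == 1 then GEqual GOne GOne
                          else GNot (GEqual (v g) GOne)))
   (GAnd (GForall 0 (GDisjs (fun g => GConjs (fun k =>
            GCommute (GMul (v g) (GVar 0)) (v k)))))
         (GForall 0 (GImplies (GConjs (fun k => GCommute (GVar 0) (v k)))
            (GExists 1 (GEqual (GPow (GVar 0) 2) (GPow (GVar 1) n)))))))).

Lemma holds_factor_formula (G : groupType) (e : nat -> G) n :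
  group_holds e (factor_formula n) <->
  exists2 h : F -> G, direct_factor h &
    forall c, (forall k, commute c (h k)) -> exists u, c ^+ 2 = u ^+ n.
Proof.
split.
  case/holds_GExistss => e' _ [/holds_GConjs mulP [/holds_GConjs kerP [splitP rootP]]].
  exists (fun g => e' (factor_var g)).
    split=> [g k | g | x].
    - by have /holds_GConjs/(_ k) := mulP g.
    - by have := kerP g; case: eqP.
    - by have /holds_GDisjs[g /holds_GConjs gP] := splitP x; exists g.
  move=> c cC; have [|u] := rootP c; first exact/holds_GConjs.
  by rewrite !group_eval_pow; exists u.
case=> h [mulP kerP splitP] rootP.
pose e' m := if [pick g | factor_var g == m] is Some g then h g else e m.
have e'E g : e' (factor_var g) = h g.
  rewrite /e'; case: pickP => [k /eqP[/(pcan_inj (@pickleK F)) ->] // | /(_ g)].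
  by rewrite eqxx.
apply/holds_GExistss; exists e'.
  move=> m mF; rewrite /e'; case: pickP => // g /eqP gm.
  by rewrite -gm map_f ?mem_enum in mF.
split; last split; last split.
- by apply/holds_GConjs => g; apply/holds_GConjs => k /=; rewrite !e'E mulP.
- apply/holds_GConjs => g; case: eqP => //= g1; rewrite e'E.
  by move/kerP.
- move=> x; apply/holds_GDisjs; have [g gP] := splitP x.
  exists g; apply/holds_GConjs => k /=; rewrite /update /= !e'E; exact: gP.
- move=> c /holds_GConjs cC; have [|u cu] := rootP c.
    by move=> k; have := cC k; rewrite /= /update /= !e'E.
  by exists u; rewrite [LHS]group_eval_pow [RHS]group_eval_pow.
Qed.

End FactorFormula.

Definition square_formula :=
  GForall 0 (GExists 1 (GEqual (GPow (GVar 0) 2) (GPow (GVar 1) (2 * 2)))).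

(** A nontrivial normal subgroup of exponent 2 would contain, with each element
    [x], the product of [x] and any conjugate of [x]; so the hypotheses of this
    sentence would hold of [x], and its conclusion would fail. *)
Definition normal2_formula :=
  GForall 0 (GImplies (GEqual (GPow (GVar 0) 2) GOne)
    (GImplies
      (GForall 1 (GEqual
        (GPow (GMul (GVar 0) (GMul (GMul (GVar 1) (GVar 0)) (GInv (GVar 1)))) 2)
        GOne))
      (GEqual (GVar 0) GOne))).

Lemma holds_square_formula (G : groupType) (e : nat -> G) :
  group_holds e square_formula <->
    forall z : G, exists u : G, z ^+ 2 = u ^+ (2 * 2).
Proof.
split=> eP z; have [u zu] := eP z; exists u.
  by move: zu; rewrite !group_eval_pow.
by rewrite [LHS]group_eval_pow [RHS]group_eval_pow.
Qed.

Lemma holds_normal2_formula (G : groupType) (e : nat -> G) :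
  group_holds e normal2_formula <-> forall x, x ^+ 2 = 1 ->
    (forall y : G, (x * (y * x * y^-1)) ^+ 2 = 1) -> x = 1.
Proof.
split=> eP x x2 xN; apply: (eP x).
- by rewrite [LHS]group_eval_pow.
- by move=> y; rewrite [LHS]group_eval_pow; exact: xN.
- by move: x2; rewrite group_eval_pow.
- by move=> y; move: (xN y); rewrite group_eval_pow.
Qed.

(** * Dihedral groups *)

Lemma expg_coprime_eq1 (gT : finGroupType) (x : gT) m n :
  coprime m n -> x ^+ m = 1 -> x ^+ n = 1 -> x = 1.
Proof.
move=> mn /eqP xm /eqP xn; apply/eqP; rewrite -order_eq1 -dvdn1.
by rewrite -(eqP mn) dvdn_gcd !order_dvdn xm.
Qed.

(** Rotations are the powers of [r], and reflections are the other elements;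
    [s] is a reflection.  The remaining facts about dihedral groups follow from
    this description. *)
Lemma dihedral_structure p : (1 < p)%N -> exists r s : dihedral_gtype (2 * p),
  [/\ r ^+ p = 1, r <> 1, r ^ s = r^-1
    & forall g, g \in <[r]> \/ g ^+ 2 = 1 /\ r ^ g = r^-1].
Proof.
move=> p1; have := homg_refl [set: dihedral_gtype (2 * p)].
have cardD := card_dihedral p1; rewrite mul2n in cardD *.
rewrite (Grp_dihedral p1) => /existsP[[r s] /= /eqP[defD rp s2 rs]].
have snr : <[s]> \subset 'N(<[r]>).
  by rewrite cycle_subG; apply/normP; rewrite -cycleJ rs cycleV.
rewrite norm_joinEr // in defD.
have os_2 : #[s] %| 2 by rewrite order_dvdn s2.
exists r, s; split=> //.
  move=> r1; have := mul_cardG <[r]> <[s]>; rewrite defD cardD r1 => E.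
  have : (p.*2 <= 1 * 2)%N.
    apply: (@leq_trans (#[1 : dihedral_gtype p.*2] * #[s])%N).
      by rewrite [leqRHS]E leq_pmulr.
    by rewrite order1 !mul1n dvdn_leq.
  by rewrite muln2 leq_double leqNgt p1.
move=> g; have : g \in <[r]> * <[s]> by rewrite defD inE.
case/mulsgP=> _ _ /cycleP[i ->] /cycleP[j ->] ->.
have -> : s ^+ j = s ^+ odd j.
  by rewrite -{1}(odd_double_half j) expgD -[j./2.*2]mul2n expgM s2 expg1n mulg1.
case: (odd j); last by left; rewrite mulg1 mem_cycle.
right; split.
  rewrite expgS expg1 {1}(conjgC (r ^+ i) s) conjXg rs expVgn mulgA mulgVK.
  by rewrite -[s * s]/(s ^+ 2) s2.
by rewrite conjgM (conjgE r (r ^+ i)) -expgS expgSr mulKg.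
Qed.

Section Dihedral.
Variable p : nat.
Hypotheses (p_odd : odd p) (p_pr : prime p).
Local Notation D := (dihedral_gtype (2 * p)).
Implicit Types d g : D.

Let p_gt1 : (1 < p)%N := prime_gt1 p_pr.

Lemma dihedral_exponents g : g ^+ p = 1 \/ g ^+ 2 = 1.
Proof.
have [r [s [rp r1 _ /(_ g)[gr|[]]]]] := dihedral_structure p_gt1; last by right.
by left; case/cycleP: gr => i ->; rewrite expgnAC rp expg1n.
Qed.

Lemma dihedral_involution_centralizer d :
  d ^+ 2 = 1 -> (forall g, g ^+ p = 1 -> commute d g) -> d = 1.
Proof.
have c2p : coprime 2 p by rewrite coprime2n.
have [r [s [rp r1 _ /(_ d)[dr|[_ rd]]]]] := dihedral_structure p_gt1 => d2 dC.
  apply: (expg_coprime_eq1 c2p) => //.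
  by case/cycleP: dr => i ->; rewrite expgnAC rp expg1n.
case: r1.
apply: (expg_coprime_eq1 c2p) => //; rewrite expgS expg1 -{1}[r]invgK -rd.
by rewrite conjgE -(dC r rp) mulKg mulVg.
Qed.

Lemma dihedral_center_trivial d : (forall g, commute d g) -> d = 1.
Proof.
move=> dC; apply: dihedral_involution_centralizer => //.
have [r [s [_ _ rs /(_ d)[|[]//]]]] := dihedral_structure p_gt1.
case/cycleP=> i di; have : d ^ s = d^-1 by rewrite di conjXg rs expVgn.
rewrite conjgE dC mulKg => dV.
by rewrite expgS expg1 {1}dV mulVg.
Qed.

(** For a reflection [d] and a rotation [r], the product of [d] and its
    conjugate by [r] is a rotation [r ^- 2], of odd order. *)
Lemma dihedral_no_normal_2subgroup d : d ^+ 2 = 1 ->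
  (forall g, (d * (g * d * g^-1)) ^+ 2 = 1) -> d = 1.
Proof.
have c2p : coprime 2 p by rewrite coprime2n.
have [r [s [rp r1 _ /(_ d)[dr|[_ rd]]]]] := dihedral_structure p_gt1 => d2 dN.
  apply: (expg_coprime_eq1 c2p) => //.
  by case/cycleP: dr => i ->; rewrite expgnAC rp expg1n.
have dV : d^-1 = d by apply/mulg1_eq; rewrite -d2.
have := dN r; have -> : d * (r * d * r^-1) = r^-1 ^+ 2.
  by rewrite -{1}dV !mulgA -(mulgA d^-1) -conjgE rd.
rewrite -expgnA expVgn => /eqP; rewrite invg_eq1 => /eqP r4.
case: r1; apply: (@expg_coprime_eq1 _ r (2 * 2) p) => //.
by rewrite coprimeMl c2p.
Qed.

(** The square of [d] has odd order [p] or 1, and [n] is invertible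
    modulo [p]. *)
Lemma dihedral_square_is_power n d :
  coprime n p -> exists u : D, d ^+ 2 = u ^+ (2 * n).
Proof.
move=> np; have d2p : d ^+ 2 ^+ p = 1.
  by have [dp|->] := dihedral_exponents d; rewrite ?expg1n // expgnAC dp expg1n.
have n0 : (0 < n)%N.
  by rewrite lt0n; apply: contraTneq np => ->; rewrite /coprime gcd0n gtn_eqF.
case: (egcdnP p n0) => k l; rewrite (eqP np) => kn _; exists (d ^+ k).
by rewrite -expgnA mulnCA expgnA kn (mulnC l) expgnDr expgnA d2p expg1n mul1g.
Qed.

Lemma dihedral_prime_torsion q g :
  odd q -> prime q -> q != p -> g ^+ q = 1 -> g = 1.
Proof.
move=> q_odd q_pr qp gq; apply: (@expg_coprime_eq1 _ g q (2 * p)%N) => //.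
  by rewrite coprimeMr coprimen2 q_odd prime_coprime // dvdn_prime2.
have cardD : #|[set: D]%SET| = (2 * p)%N by rewrite mul2n; exact: (card_dihedral p_gt1).
by apply/eqP; rewrite -order_dvdn -{2}cardD order_dvdG ?inE.
Qed.

End Dihedral.

(** * Projection onto a centerless direct factor *)

Section Projection.
Variables (F : finGroupType) (G : groupType) (h : F -> G).
Hypothesis hF : direct_factor h.
Hypothesis F_centerless : forall d : F, (forall g, commute d g) -> d = 1.

Let hM := factor_morph hF.

Lemma factor1 : h 1 = 1.
Proof. by apply: (@mulgI _ (h 1)); rewrite -hM !mulg1. Qed.

Lemma factorV g : h g^-1 = (h g)^-1.
Proof. by apply: (@mulgI _ (h g)); rewrite -hM !mulgV factor1. Qed.

Lemma factorX g n : h (g ^+ n) = h g ^+ n.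
Proof.
elim: n => [|n IH]; first by rewrite !expg0 factor1.
by rewrite !expgS hM IH.
Qed.

Lemma factor_inj : injective h.
Proof.
move=> g k hgk; apply: divg1_eq; apply: (factor_ker1 hF).
by rewrite hM factorV hgk mulgV.
Qed.

Fact factor_proj_exists x :
  exists g, forall k, commute (h g^-1 * x) (h k).
Proof. by have [g gP] := factor_split hF x; exists g^-1; rewrite invgK. Qed.

(** The component of [x] in [F] along the centralizer of [h @` F]. *)
Definition factor_proj x : F := projT1 (cid (factor_proj_exists x)).

Lemma factor_projP x k : commute (h (factor_proj x)^-1 * x) (h k).
Proof. exact: (projT2 (cid (factor_proj_exists x))). Qed.

(** Two candidates differ by an element of [F] that centralizes [F]. *)
Lemma factor_proj_unique x g :
  (forall k, commute (h g^-1 * x) (h k)) -> factor_proj x = g.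
Proof.
move: (factor_proj x) (@factor_projP x) => d dP gP.
suff /mulg1_eq <- : g^-1 * d = 1 by rewrite invgK.
apply: F_centerless => k; apply: factor_inj; rewrite (hM _ k) (hM k).
have -> : h (g^-1 * d) = (h g^-1 * x) * (h d^-1 * x)^-1.
  by rewrite invgM (factorV d) invgK mulgA mulgK hM.
by apply/commute_sym/commuteM; [|apply: commuteV]; exact: commute_sym.
Qed.

Lemma factor_proj_eqP x g :
  factor_proj x = g <-> forall k, commute (h g^-1 * x) (h k).
Proof. by split=> [<- k|/factor_proj_unique//]; exact: factor_projP. Qed.

Lemma factor_proj_morph : {morph factor_proj : x y / x * y}.
Proof.
move=> x y; apply: factor_proj_unique => k.
set g := factor_proj x; set d := factor_proj y.
have -> : h (g * d)^-1 * (x * y) = (h g^-1 * x) * (h d^-1 * y).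
  by rewrite invgM hM -mulgA (mulgA (h g^-1)) mulgA -factor_projP mulgA.
by apply/commute_sym/commuteM; apply/commute_sym/factor_projP.
Qed.

Lemma factor_projK : cancel h factor_proj.
Proof.
move=> g; apply: factor_proj_unique => k.
by rewrite -hM mulVg factor1; apply: commute_sym; exact: commute1.
Qed.

Lemma factor_proj1 : factor_proj 1 = 1.
Proof. by rewrite -factor1 factor_projK. Qed.

Lemma factor_projX x n : factor_proj (x ^+ n) = factor_proj x ^+ n.
Proof.
elim: n => [|n IH]; first by rewrite !expg0 factor_proj1.
by rewrite !expgS factor_proj_morph IH.
Qed.

Lemma factor_projV x : factor_proj x^-1 = (factor_proj x)^-1.
Proof.
by apply: (@mulgI _ (factor_proj x)); rewrite -factor_proj_morph !mulgV factor_proj1.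
Qed.

Lemma factor_proj_eq1 x : factor_proj x = 1 <-> forall k, commute x (h k).
Proof.
rewrite factor_proj_eqP invg1 factor1.
by split=> xk k; have := xk k; rewrite mul1g.
Qed.

End Projection.

(** * Sentences true in the product of the dihedral groups *)

Section DihedralProduct.
Local Notation G := dihedral_product.

Lemma odd_primeP (p : odd_prime) : odd (val p) /\ prime (val p).
Proof. exact: andP (valP p). Qed.

Lemma odd_prime_coprime (p q : odd_prime) : p != q -> coprime (val p) (val q).
Proof.
have [[_ p_pr] [_ q_pr]] := (odd_primeP p, odd_primeP q).
by rewrite prime_coprime // dvdn_prime2.
Qed.

Lemma product_mulE (x y : G) p :
  (x * y) p = (x p : dihedral_gtype (2 * val p)) * y p.
Proof. by []. Qed.

Lemma product_invE (x : G) p : x^-1 p = (x p : dihedral_gtype (2 * val p))^-1.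
Proof. by []. Qed.

Lemma product_expE (x : G) n p : (x ^+ n) p = (x p : dihedral_gtype (2 * val p)) ^+ n.
Proof. by elim: n => [|n IH] //; rewrite !expgS product_mulE IH. Qed.

Definition inject (p : odd_prime) (g : dihedral_gtype (2 * val p)) : G :=
  dfwith (fun=> 1) p g.

Lemma injectE p g : inject g p = g.
Proof. exact: dfwithin. Qed.

Lemma inject_neq p q (g : dihedral_gtype (2 * val p)) : p != q -> inject g q = 1.
Proof. exact: dfwithout. Qed.

Lemma commute_injectP p (c : G) :
  (forall g : dihedral_gtype (2 * val p), commute c (inject g)) <-> c p = 1.
Proof.
have [p_odd p_pr] := odd_primeP p.
split=> [cP | cp g].
  apply: (dihedral_center_trivial p_odd p_pr) => g.
  have : (c * inject g) p = (inject g * c) p by rewrite cP.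
  by rewrite !product_mulE injectE.
apply: functional_extensionality_dep => q.
rewrite !product_mulE; have [<-|pq] := eqVneq p q; first by rewrite cp mul1g mulg1.
by rewrite inject_neq // mul1g mulg1.
Qed.

Lemma direct_factor_inject p : direct_factor (@inject p).
Proof.
split=> [g k | g g1 | x].
- apply: functional_extensionality_dep => q.
  rewrite product_mulE; have [<-|pq] := eqVneq p q; first by rewrite !injectE.
  by rewrite !inject_neq // mulg1.
- by rewrite -(injectE g) g1.
- exists (x p)^-1; apply/commute_injectP.
  by rewrite product_mulE injectE mulVg.
Qed.

(** The alternative [c q = 1] is for the one prime that may divide [n]. *)
Lemma product_square_is_power (c : G) (n : nat) :
  (forall q, c q = 1 \/ coprime n (val q)) -> exists u, c ^+ 2 = u ^+ (2 * n).
Proof.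
move=> cn; have uP q : exists u : dihedral_gtype (2 * val q),
    (c q : dihedral_gtype _) ^+ 2 = u ^+ (2 * n).
  have [q_odd q_pr] := odd_primeP q.
  have [->|nq] := cn q; last exact: dihedral_square_is_power.
  by exists 1; rewrite !expg1n.
exists (fun q => projT1 (cid (uP q))).
apply: functional_extensionality_dep => q.
by rewrite !product_expE; exact: projT2 (cid (uP q)).
Qed.

Lemma product_factor_formula (p : odd_prime) (e : nat -> G) :
  group_holds e (factor_formula (dihedral_gtype (2 * val p)) (2 * val p)).
Proof.
apply/holds_factor_formula; exists (@inject p).
  exact: direct_factor_inject.
move=> c /commute_injectP cp; apply: product_square_is_power => q.
have [<-|pq] := eqVneq p q; first by left.
by right; exact: odd_prime_coprime.
Qed.

Lemma product_square_formula (e : nat -> G) : group_holds e square_formula.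
Proof.
apply/holds_square_formula => z; apply: product_square_is_power => q.
by right; rewrite coprime2n; case: (odd_primeP q).
Qed.

Lemma product_normal2_formula (e : nat -> G) : group_holds e normal2_formula.
Proof.
apply/holds_normal2_formula => x x2 xN.
apply: functional_extensionality_dep => q.
have [q_odd q_pr] := odd_primeP q.
apply: (dihedral_no_normal_2subgroup q_odd q_pr) => [|g].
  by rewrite -product_expE x2.
have := xN (inject g) => /(congr1 (fun y : G => y q)).
by rewrite product_expE !product_mulE product_invE injectE.
Qed.

End DihedralProduct.

(** * Profinite groups satisfying these sentences *)

Section Isomorphism.
Variable L : profiniteGroupType.
Variable h : forall p : odd_prime, dihedral_gtype (2 * val p) -> L.
Hypothesis hF : forall p, direct_factor (h (p := p)).
Hypothesis hroot : forall p c, (forall k, commute c (h (p := p) k)) ->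
  exists u, c ^+ 2 = u ^+ (2 * val p).
Hypothesis square_is_fourth_power : forall z : L, exists u, z ^+ 2 = u ^+ (2 * 2).
Hypothesis no_normal2 : forall x : L, x ^+ 2 = 1 ->
  (forall y : L, (x * (y * x * y^-1)) ^+ 2 = 1) -> x = 1.

Let centerless p := dihedral_center_trivial (odd_primeP p).1 (odd_primeP p).2.

Definition coord p (x : L) : dihedral_gtype (2 * val p) := factor_proj (hF p) x.

Lemma coordM p : {morph @coord p : x y / x * y}.
Proof. exact: (factor_proj_morph (hF p) (@centerless p)). Qed.

Lemma coordK p : cancel (h (p := p)) (@coord p).
Proof. exact: (factor_projK (hF p) (@centerless p)). Qed.

Lemma coord1 p : coord p 1 = 1.
Proof. exact: (factor_proj1 (hF p) (@centerless p)). Qed.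

Lemma coordX p x n : coord p (x ^+ n) = coord p x ^+ n.
Proof. exact: (factor_projX (hF p) (@centerless p)). Qed.

Lemma coordV p x : coord p x^-1 = (coord p x)^-1.
Proof. exact: (factor_projV (hF p) (@centerless p)). Qed.

Lemma coord_eq1 p x : coord p x = 1 <-> forall k, commute x (h (p := p) k).
Proof. exact: (factor_proj_eq1 (hF p) (@centerless p)). Qed.

(** Each fibre is defined by finitely many equations, hence closed, and the
    preimage of any set is a finite union of fibres. *)
Lemma coord_continuous p :
  continuous (coord p : L -> discrete_topology (dihedral_gtype (2 * val p))).
Proof.
pose hp := h (p := p); apply/continuous_closedP => A _.
have -> : coord p @^-1` A = \bigcup_(g in A) \bigcap_(k in setT)
    [set x | hp g^-1 * x * hp k = hp k * (hp g^-1 * x)].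
  apply/seteqP; split=> [x Ax | x [g Ag gP]].
    by exists (coord p x) => // k _; exact: factor_projP.
  suff xg : coord p x = g by rewrite /preimage /= xg.
  by apply: (factor_proj_unique (hF p) (@centerless p)) => k; exact: gP.
apply: closed_bigcup.
  by apply: (sub_finite_set (@subsetT _ A)); exact: (@finite_finset (dihedral_gtype _)).
move=> g _; apply: closed_bigI => k _; apply: closed_equalizer.
- exact: profinite_hausdorff.
- move=> x; apply: (continuous_comp (f := fun y => hp g^-1 * y)
    (g := fun y => y * hp k)).
    exact: mulgl_continuous.
  exact: mulgr_continuous.
- move=> x; apply: (continuous_comp (f := fun y => hp g^-1 * y)
    (g := fun y => hp k * y)).
    exact: mulgl_continuous.
  exact: mulgl_continuous.
Qed.

Lemma coord_rotation_neq (p q : odd_prime) (g : dihedral_gtype (2 * val q)) :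
  p != q -> g ^+ val q = 1 -> coord p (h g) = 1.
Proof.
move=> pq gq; have [q_odd q_pr] := odd_primeP q.
apply: (dihedral_prime_torsion (odd_primeP p).2 q_odd q_pr).
  by rewrite eq_sym.
by rewrite -coordX -(factorX (hF q)) gq (factor1 (hF q)) coord1.
Qed.

(** Rotations of [D_q] project trivially to [D_p] since their order is prime to
    [2 * p].  Exchanging [p] and [q], the rotations of [D_p] commute with
    [D_q]; hence a reflection of [D_q] projects to an element of order at most
    2 that centralizes the rotations of [D_p], and only 1 is such. *)
Lemma coord_factor_neq (p q : odd_prime) (g : dihedral_gtype (2 * val q)) :
  p != q -> coord p (h g) = 1.
Proof.
move=> pq.
have [p_odd p_pr] := odd_primeP p; have [q_odd q_pr] := odd_primeP q.
have [gq|g2] := dihedral_exponents q_pr g; first exact: coord_rotation_neq.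
apply: (dihedral_involution_centralizer p_odd p_pr).
  by rewrite -coordX -(factorX (hF q)) g2 (factor1 (hF q)) coord1.
move=> r rp; have /coord_eq1/(_ g) hrg : coord q (h r) = 1.
  by apply: coord_rotation_neq => //; rewrite eq_sym.
by rewrite -(coordK r) /commute -!coordM hrg.
Qed.

(** Coordinates in a finite list are corrected one at a time: multiplying by an
    element of [D_p] does not disturb the other ones. *)
Lemma coord_surjective (y : dihedral_product) : exists x, forall p, coord p x = y p.
Proof.
have [||||x xP] := compact_bigcap_nonempty (D := [set: seq odd_prime])
  (f := fun s => [set x | forall p, p \in s -> coord p x = y p])
  (@profinite_compact L).
- by exists [::].
- move=> s1 s2 _ _; exists (s1 ++ s2) => // x xP.
  by split=> p ps; apply: xP; rewrite mem_cat ps ?orbT.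
- move=> s _.
  have -> : [set x | forall p, p \in s -> coord p x = y p] =
      \bigcap_(p in [set p | p \in s]) (coord p @^-1` [set y p]) by [].
  apply: closed_bigI => p _.
  have /continuous_closedP := @coord_continuous p; apply.
  exact: discrete_closed.
- move=> s _; elim: s => [|p s [x xP]]; first by exists 1.
  have [ps|ps] := boolP (p \in s).
    by exists x => q; rewrite inE => /predU1P[->|/xP//]; apply: xP.
  exists (h (y p * (coord p x)^-1) * x) => q; rewrite inE coordM.
  have [->|qp] := eqVneq q p; first by rewrite coordK mulgVK.
  by move=> /= /xP <-; rewrite coord_factor_neq // mul1g.
- by exists x => p; apply: (xP [:: p]); rewrite ?mem_head.
Qed.

(** Induction on [n], removing one prime factor [q] at a time; for odd [q] the
    hypothesis on squares applies only to the part of [z] that centralizes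
    [D_q], and the part in [D_q] disappears because [x] projects trivially. *)
Lemma coord_kernel_square_divisible x : (forall p, coord p x = 1) ->
  forall n, (0 < n)%N -> exists z, x ^+ 2 = z ^+ (2 * n).
Proof.
move=> x1 n; elim/ltn_ind: n => n IH n0.
have [n1|n1] := leqP n 1.
  by exists x; rewrite (_ : n = 1%N) //; apply/eqP; rewrite eqn_leq n1.
have q_pr := pdiv_prime n1; have qn := pdiv_dvd n.
move: (pdiv n) q_pr qn => q q_pr /dvdnP[m nE].
have m0 : (0 < m)%N by move: n0; rewrite nE muln_gt0 => /andP[].
have mn : (m < n)%N by rewrite nE ltn_Pmulr // prime_gt1.
have [z xz] := IH m mn m0.
(* The factor 2 is removed by the existence of fourth roots of squares. *)
have [q2|q_odd] := even_prime q_pr.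
  have [u zu] := square_is_fourth_power z; exists u.
  by rewrite xz expgnA zu -expgnA nE q2 -mulnA (mulnC m).
have q_op : odd q && prime q by rewrite q_odd.
pose p : odd_prime := Sub q q_op.
(* [z] = [h d] * [c] with commuting factors, and only [c] matters. *)
pose d := coord p z; pose c := h d^-1 * z.
have cC k : commute c (h (p := p) k) by exact: (factor_projP (hF p) z k).
have zE : z = h d * c by rewrite /c (factorV (hF p)) mulVKg.
have [u cu] := hroot cC; exists u.
have x2E : x ^+ 2 = h (d ^+ (2 * m)) * c ^+ (2 * m).
  by rewrite xz zE expgMn ?(factorX (hF p)) //; apply: commute_sym.
have d1 : d ^+ (2 * m) = 1.
  by rewrite -coordX -xz coordX x1 expg1n.
by rewrite x2E d1 (factor1 (hF p)) mul1g expgnA cu -expgnA nE -mulnA (mulnC m).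
Qed.

Lemma coord_kernel_trivial x : (forall p, coord p x = 1) -> x = 1.
Proof.
have sq1 w : (forall p, coord p w = 1) -> w ^+ 2 = 1.
  move=> w1; apply: infinitely_divisible_eq1 => n n0.
  by have [z ->] := coord_kernel_square_divisible w1 n0; exists (z ^+ 2); rewrite expgnA.
move=> x1; apply: no_normal2; first exact: sq1.
by move=> y; apply: sq1 => p; rewrite !coordM coordV x1 mulg1 mul1g mulgV.
Qed.

Lemma dihedral_product_isomorphic : profinite_isomorphic L dihedral_product.
Proof.
pose f x : dihedral_product := fun p => coord p x.
pose g y := projT1 (cid (coord_surjective y)).
have fM : {morph f : x y / x * y}.
  by move=> x y; apply: functional_extensionality_dep => p; exact: coordM.
have gK : cancel g f.
  move=> y; apply: functional_extensionality_dep.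
  exact: (projT2 (cid (coord_surjective y))).
have fK : cancel f g.
  move=> x; apply: divg1_eq; apply: coord_kernel_trivial => p.
  by rewrite coordM coordV -[coord p (g _)]/(f (g (f x)) p) gK mulgV.
have cf : continuous f by apply: prod_topology_continuous; exact: coord_continuous.
exists f, g; split=> //.
exact: bijective_continuous_inv (@profinite_compact L)
  (@profinite_hausdorff dihedral_product) cf fK gK.
Qed.

End Isomorphism.

Theorem theorem1p1 : axiomatizable dihedral_product.
Proof.
move=> L LG; pose transfer f := @first_order_transfer _ L f LG.
have hP (p : odd_prime) : exists h : dihedral_gtype (2 * val p) -> L,
    direct_factor h /\ forall c, (forall k, commute c (h k)) ->
      exists u, c ^+ 2 = u ^+ (2 * val p).
  have /holds_factor_formula[h hF hroot] :=
    transfer _ (@product_factor_formula p) (fun=> 1).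
  by exists h.
pose h p := projT1 (cid (hP p)).
apply: (@dihedral_product_isomorphic L h).
- by move=> p; have [] := projT2 (cid (hP p)).
- by move=> p; have [] := projT2 (cid (hP p)).
- have := transfer _ product_square_formula (fun=> 1).
  by move/holds_square_formula.
- have := transfer _ product_normal2_formula (fun=> 1).
  by move/holds_normal2_formula.
Qed.
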